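(* Let $\eta^{(\varepsilon)}(t)$, $\varepsilon\in(0,1]$, be semi-Markov processes on $\mathbb{X}=\{1,\dots,N\}$ as in the context, satisfying conditions A, B, C, D, E of the context for some $\varepsilon_0\in(0,1]$ and transition sets $\mathbb{Y}_i$. Fix $r\in\mathbb{X}$, assume $\mathsf P\{\eta^{(\varepsilon)}_0=r\}=0$, and let $_r\eta^{(\varepsilon)}(t)$ be the reduced semi-Markov process on $_r\mathbb{X}=\mathbb{X}\setminus\{r\}$. Then conditions A, B, C, D, E hold for the processes $_r\eta^{(\varepsilon)}(t)$ (with transition probabilities $_rp_{ij}(\varepsilon)$ and expectations $_re_{ij}(\varepsilon)$ in place of $p_{ij}(\varepsilon)$, $e_{ij}(\varepsilon)$), with the same parameter $\varepsilon_0$ and transition sets $_r\mathbb{Y}_i=\mathbb{Y}^-_{ir}\cup\mathbb{Y}^+_{ir}$, $i\in{}_r\mathbb{X}$; in particular, for every $j\in{}_r\mathbb{Y}_i$, $_re_{ij}(\varepsilon)$ admits a pivotal $(_rm^-_{ij},{}_rm^+_{ij})$-expansion on $(0,\varepsilon_0]$ with positive leading coefficient.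
   Context: A $(h,k)$-expansion of $A$ on $(0,\varepsilon_0]$: $A(\varepsilon)=\sum_{l=h}^k a_l\varepsilon^l+o_A(\varepsilon^k)$ with integers $h\le k$, real $a_l$, $o_A(\varepsilon^k)/\varepsilon^k\to0$; pivotal means $a_h\neq0$. Setting: for $\varepsilon\in(0,1]$, $(\eta^{(\varepsilon)}_n,\kappa^{(\varepsilon)}_n)$, $n\ge0$, is a homogeneous Markov chain on $\mathbb{X}\times[0,\infty)$, $\kappa^{(\varepsilon)}_0=0$, with transition probabilities $Q^{(\varepsilon)}_{ij}(t)=\mathsf P\{\eta^{(\varepsilon)}_1=j,\kappa^{(\varepsilon)}_1\le t\mid\eta^{(\varepsilon)}_0=i,\kappa^{(\varepsilon)}_0=s\}$ not depending on $s$; $p_{ij}(\varepsilon)=Q^{(\varepsilon)}_{ij}(\infty)$ (stochastic matrix); $e_{ij}(\varepsilon)=\int_0^\infty t\,Q^{(\varepsilon)}_{ij}(dt)$; $\eta^{(\varepsilon)}(t)=\eta^{(\varepsilon)}_{\nu^{(\varepsilon)}(t)}$, $\nu^{(\varepsilon)}(t)=\max\{n\ge0:\kappa^{(\varepsilon)}_1+\dots+\kappa^{(\varepsilon)}_n\le t\}$. Conditions: A: there exist $\mathbb{Y}_i\subseteq\mathbb{X}$ and $\varepsilon_0\in(0,1]$ with, for $\varepsilon\in(0,\varepsilon_0]$, (a) $p_{ij}(\varepsilon)>0$, $j\in\mathbb{Y}_i$; (b) $p_{ij}(\varepsilon)=0$, $j\notin\mathbb{Y}_i$; (c) for all $i,j$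 there exist $n\ge1$, $i=l_0,\dots,l_n=j$ with $l_{k+1}\in\mathbb{Y}_{l_k}$. B: $Q^{(\varepsilon)}_{ij}(0)=0$. C: $e_{ij}(\varepsilon)<\infty$. D: for $j\in\mathbb{Y}_i$, $p_{ij}(\varepsilon)=\sum_{l=l^-_{ij}}^{l^+_{ij}}a_{ij}[l]\varepsilon^l+o_{ij}(\varepsilon^{l^+_{ij}})$ on $(0,\varepsilon_0]$ with integers $0\le l^-_{ij}\le l^+_{ij}$, $a_{ij}[l^-_{ij}]>0$, $o_{ij}(\varepsilon^{l^+_{ij}})/\varepsilon^{l^+_{ij}}\to0$. E: for $j\in\mathbb{Y}_i$, $e_{ij}(\varepsilon)=\sum_{l=m^-_{ij}}^{m^+_{ij}}b_{ij}[l]\varepsilon^l+\dot o_{ij}(\varepsilon^{m^+_{ij}})$ on $(0,\varepsilon_0]$ with integers $m^-_{ij}\le m^+_{ij}$, $b_{ij}[m^-_{ij}]>0$, $\dot o_{ij}(\varepsilon^{m^+_{ij}})/\varepsilon^{m^+_{ij}}\to0$. (B and C are required for all $i,j$ and $\varepsilon\in(0,\varepsilon_0]$.) Reduced process: $_r\xi_0=0$, $_r\xi_n=\min\{k>{}_r\xi_{n-1}:\eta^{(\varepsilon)}_k\in{}_r\mathbb{X}\}$; $_r\eta^{(\varepsilon)}_n=\eta^{(\varepsilon)}_{_r\xi_n}$, $_r\kappa^{(\varepsilon)}_0=0$, $_r\kappa^{(\varepsilon)}_n=\sum_{k={}_r\xi_{n-1}+1}^{_r\xi_n}\kappa^{(\varepsilon)}_k$;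 this is a Markov renewal process on $_r\mathbb{X}\times[0,\infty)$ with transition probabilities $_rQ^{(\varepsilon)}_{ij}(t)$, and $_r\eta^{(\varepsilon)}(t)$ is its semi-Markov process. $_rp_{ij}(\varepsilon)={}_rQ^{(\varepsilon)}_{ij}(\infty)$, $_re_{ij}(\varepsilon)=\int_0^\infty t\,{}_rQ^{(\varepsilon)}_{ij}(dt)$. Sets: $\mathbb{Y}^-_{ir}=\{j\in{}_r\mathbb{X}:j\in\mathbb{Y}_r\}$ if $r\in\mathbb{Y}_i$, else $\emptyset$; $\mathbb{Y}^+_{ir}=\{j\in{}_r\mathbb{X}:j\in\mathbb{Y}_i\}$. *)

(* Defs.v *)
From HB Require Import structures.
From mathcomp Require Import all_boot all_order all_algebra.
From mathcomp Require Import all_classical all_reals all_analysis.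
Set Implicit Arguments. Unset Strict Implicit. Unset Printing Implicit Defensive.
Import Order.TTheory GRing.Theory Num.Theory.
Import numFieldNormedType.Exports.
Local Open Scope classical_set_scope.
Local Open Scope ring_scope.

Section Defs.
Variables (R : realType) (N : nat).

(* (h,k)-expansion of A on (0,eps0] (only the behaviour near 0 matters,
   the remainder o_A(eps) := A(eps) - sum_{l=h}^k a_l eps^l is then
   defined on (0,eps0]):
     h <= k  and  (A(eps) - sum_{l=h}^k a_l eps^l) / eps^k -> 0 as eps -> 0+ *)
Definition expansion_sum (a : int -> R) (h k : int) (x : R) : R :=
  \sum_(n < (absz (k - h)).+1) a (h + n%:Z) * x ^ (h + n%:Z).

Definition has_expansion (A : R -> R) (h k : int) (a : int -> R) : Prop :=
  (h <= k)%R /\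
  (fun x => (A x - expansion_sum a h k x) / x ^ k) x @[x --> 0^'+] --> (0 : R).

Definition pos_pivotal_expansion (A : R -> R) (h k : int) (a : int -> R) : Prop :=
  has_expansion A h k a /\ 0 < a h.

(* Conditions A--E for a family of semi-Markov kernels on the state set S
   (a subset of 'I_N; the states 1..N of the paper are 0..N-1 here),
   with transition sets Y, distribution functions Q eps i j t,
   transition probabilities p eps i j and expectations e eps i j.       *)
Definition condA (S : {set 'I_N}) (Y : 'I_N -> {set 'I_N})
  (p : R -> 'I_N -> 'I_N -> R) (eps0 : R) : Prop :=
  (forall i, i \in S -> Y i \subset S) /\
  (forall eps, 0 < eps <= eps0 -> forall i j, i \in S -> j \in S ->
     (j \in Y i -> 0 < p eps i j) /\ (j \notin Y i -> p eps i j = 0)) /\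
  (forall i j, i \in S -> j \in S ->
     exists n (l : nat -> 'I_N), [/\ (0 < n)%N, l 0%N = i, l n = j &
       forall k, (k < n)%N -> l k.+1 \in Y (l k)]).

Definition condB (S : {set 'I_N}) (Q : R -> 'I_N -> 'I_N -> R -> R) (eps0 : R) :=
  forall eps, 0 < eps <= eps0 -> forall i j, i \in S -> j \in S -> Q eps i j 0 = 0.

Definition condC (S : {set 'I_N}) (e : R -> 'I_N -> 'I_N -> \bar R) (eps0 : R) :=
  forall eps, 0 < eps <= eps0 -> forall i j, i \in S -> j \in S -> (e eps i j < +oo)%E.

Definition condD (S : {set 'I_N}) (Y : 'I_N -> {set 'I_N})
  (p : R -> 'I_N -> 'I_N -> R) :=
  forall i j, i \in S -> j \in S -> j \in Y i ->
    exists (lm lp : int) (a : int -> R),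
      (0 <= lm)%R /\ pos_pivotal_expansion (fun eps => p eps i j) lm lp a.

Definition condE (S : {set 'I_N}) (Y : 'I_N -> {set 'I_N})
  (e : R -> 'I_N -> 'I_N -> \bar R) :=
  forall i j, i \in S -> j \in S -> j \in Y i ->
    exists (mm mp : int) (b : int -> R),
      pos_pivotal_expansion (fun eps => fine (e eps i j)) mm mp b.

Definition condsABCDE (S : {set 'I_N}) (Y : 'I_N -> {set 'I_N})
  (Q : R -> 'I_N -> 'I_N -> R -> R) (p : R -> 'I_N -> 'I_N -> R)
  (e : R -> 'I_N -> 'I_N -> \bar R) (eps0 : R) : Prop :=
  [/\ condA S Y p eps0, condB S Q eps0, condC S e eps0, condD S Y p & condE S Y e].

(* Markov renewal processes.  For every eps, T eps is a measurable space
   carrying the chain (eta_ eps n, kappa_ eps n), n >= 0, and P eps i is the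
   law of the chain started at eta_0 = i (a Markov family).             *)
Variables (d : measure_display) (T : R -> measurableType d)
  (P : forall eps, 'I_N -> probability (T eps) R)
  (eta_ : forall eps, nat -> T eps -> 'I_N)
  (kappa_ : forall eps, nat -> T eps -> R).
Arguments P : clear implicits.
Arguments eta_ : clear implicits.
Arguments kappa_ : clear implicits.

Definition kerQ (eps : R) (i j : 'I_N) (t : R) : R :=
  fine (P eps i [set w : T eps | eta_ eps 1 w = j /\ kappa_ eps 1 w <= t]).
Definition kerp (eps : R) (i j : 'I_N) : R :=
  fine (P eps i [set w : T eps | eta_ eps 1 w = j]).
(* e_{ij}(eps) = int t Q_{ij}(dt) = E_i[kappa_1 ; eta_1 = j] *)
Definition kere (eps : R) (i j : 'I_N) : \bar R :=
  (\int[P eps i]_w ((eta_ eps 1 w == j)%:R * kappa_ eps 1 w)%:E)%E.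

(* (eta_, kappa_) is a homogeneous Markov renewal process for every eps in (0,1]:
   eta_0 = i a.s. under P_i, kappa_0 = 0, kappa_n in [0,oo), and the
   finite-dimensional distributions are given by the kernel Q:
   P_{s_0}{eta_k = s_k, kappa_k <= t_k, 1 <= k <= n} = prod_k Q_{s_{k-1} s_k}(t_k). *)
Definition MRP_family : Prop :=
  forall eps, 0 < eps <= 1 ->
  [/\ ((forall n j, measurable [set w : T eps | eta_ eps n w = j]) /\
       (forall n, measurable_fun setT (kappa_ eps n))),
      (forall w, kappa_ eps 0 w = 0),
      (forall n w, 0 <= kappa_ eps n w),
      (forall i, P eps i [set w : T eps | eta_ eps 0 w = i] = 1%E) &
      (forall (n : nat) (s : nat -> 'I_N) (t : nat -> R),
         fine (P eps (s 0%N) [set w : T eps | forall k, (0 < k <= n)%N ->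
                                   eta_ eps k w = s k /\ kappa_ eps k w <= t k])
         = \prod_(1 <= k < n.+1) kerQ eps (s k.-1) (s k) (t k))].

(* Reduced process: removal of the state r.  The first step n >= 1 at which
   the chain enters rX = X \ {r}, and it enters it at state j.          *)
Definition first_exit (r : 'I_N) (eps : R) (n : nat) (j : 'I_N) (w : T eps) : bool :=
  [&& (0 < n)%N, eta_ eps n w == j & all (fun m => eta_ eps m w == r) (iota 1 n.-1)].

Definition sum_kappa (eps : R) (n : nat) (w : T eps) : R :=
  \sum_(1 <= k < n.+1) kappa_ eps k w.

(* _rQ_{ij}(t) = P_i{_r eta_1 = j, _r kappa_1 <= t} *)
Definition redQ (r : 'I_N) (eps : R) (i j : 'I_N) (t : R) : R :=
  fine (P eps i [set w : T eps | exists n, first_exit r n j w /\ sum_kappa n w <= t]).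
Definition redp (r : 'I_N) (eps : R) (i j : 'I_N) : R :=
  fine (P eps i [set w : T eps | exists n, first_exit r n j w]).
(* _re_{ij}(eps) = E_i[_r kappa_1 ; _r eta_1 = j] *)
Definition rede (r : 'I_N) (eps : R) (i j : 'I_N) : \bar R :=
  (\int[P eps i]_w (\sum_(n <oo) ((first_exit r n j w)%:R * sum_kappa n w)%:E))%E.

End Defs.

Definition Yminus (N : nat) (Y : 'I_N -> {set 'I_N}) (i r : 'I_N) : {set 'I_N} :=
  [set j | (r \in Y i) && (j \in Y r) && (j != r)].
Definition Yplus (N : nat) (Y : 'I_N -> {set 'I_N}) (i r : 'I_N) : {set 'I_N} :=
  [set j | (j \in Y i) && (j != r)].
Definition redY (N : nat) (Y : 'I_N -> {set 'I_N}) (r : 'I_N) (i : 'I_N) : {set 'I_N} :=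
  Yminus Y i r :|: Yplus Y i r.

(* Main.v *)
(** Splitting the excursions of the chain through [r] by their length gives
      rp_ij = p_ij + p_ir p_rj / (1 - p_rr),
      re_ij = e_ij + (e_ir p_rj + p_ir e_rj) / (1 - p_rr)
              + p_ir p_rj e_rr / (1 - p_rr)^2,
    by summing geometric and arithmetic-geometric series.  Since
    1 - p_rr is the sum of the p_rk with k <> r, these formulas involve only
    sums, products and inverses of quantities which either vanish identically
    or behave like c x^h with c > 0 as x -> 0+.  This class is stable under
    those operations: no cancellation of leading terms can occur.  An expansion
    may be truncated after its leading term, so (h, h)-expansions suffice; that
    h >= 0 for rp_ij follows from rp_ij <= 1. *)

Require Import Defs.
From HB Require Import structures.
From mathcomp Require Import all_boot all_order all_algebra.
From mathcomp Require Import all_classical all_reals all_analysis.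
From mathcomp Require Import measurable_realfun ring zify.
Set Implicit Arguments. Unset Strict Implicit. Unset Printing Implicit Defensive.
Import Order.TTheory GRing.Theory Num.Theory.
Import numFieldNormedType.Exports.
Local Open Scope classical_set_scope.
Local Open Scope ring_scope.

(** * Functions equivalent to a positive multiple of a power at 0+ *)

Section PowerOrder.
Context {R : realType}.
Implicit Types (A B : R -> R) (h k : int) (c : R).

(* Equivalently, [A] has a pivotal expansion with positive leading coefficient. *)
Definition has_order A : Prop :=
  exists h c, 0 < c /\ A x / x ^ h @[x --> 0^'+] --> c.

(** Vanishing is asked only near 0, since the kernels are controlled only on (0, [eps0]]. *)
Definition zero_or_order A : Prop :=
  (\forall x \near 0^'+, A x = 0) \/ has_order A.

Lemma cvg_exprn_at_right0 (n : nat) :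
  x ^+ n @[x --> (0 : R)^'+] --> ((n == 0)%:R : R).
Proof.
rewrite -expr0n; apply: cvg_at_right_filter; exact: exprn_continuous.
Qed.

Lemma cvg_exprz_at_right0 h : 0 <= h ->
  x ^ h @[x --> (0 : R)^'+] --> ((h == 0)%:R : R).
Proof. by case: h => // n _; exact: cvg_exprn_at_right0. Qed.

Lemma near_eq_cvg_to {A} B {l : R} : A x @[x --> 0^'+] --> l ->
  (\forall x \near 0^'+, A x = B x) -> B x @[x --> 0^'+] --> l.
Proof. by move=> Al AB; apply: cvg_trans Al; apply: near_eq_cvg. Qed.

Lemma near_has_order A B :
  (\forall x \near 0^'+, A x = B x) -> has_order A -> has_order B.
Proof.
move=> AB [h [c [c0 Ac]]]; exists h, c; split => //.
by apply: (near_eq_cvg_to Ac); apply: filterS AB => x ->.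
Qed.

(** Division by [x ^ h] leaves an o(1) quantity times [x ^ (k - h)], with [k - h >= 0], plus a
    polynomial in [x] with constant term [a h]. *)
Lemma pivotal_has_order A h k a : pos_pivotal_expansion A h k a -> has_order A.
Proof.
move=> [[hk Aexp] ah0]; exists h, (a h); split => //.
have kh0 : 0 <= k - h by rewrite subr_ge0.
have S_cvg : \sum_(n < (absz (k - h)).+1) a (h + n%:Z) * x ^+ n
    @[x --> (0 : R)^'+] --> a h.
  rewrite [X in _ --> X](_ : _ =
      \sum_(n < (absz (k - h)).+1) a (h + n%:Z) * (n == 0 :> nat)%:R); last first.
    by rewrite big_ord_recl /= addr0 mulr1 big1 ?addr0// => n _; rewrite mulr0.
  apply: cvg_big => [|n _]; first exact: add_continuous.
  by apply: cvgM; [exact: cvg_cst|exact: cvg_exprn_at_right0].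
have -> : a h = 0 * (k - h == 0)%:R + a h by rewrite mul0r add0r.
apply: (near_eq_cvg_to (cvgD (cvgM Aexp (cvg_exprz_at_right0 kh0)) S_cvg)).
near=> x; have x0 : x != 0 by rewrite gt_eqF//; near: x; exact: nbhs_right_gt.
rewrite /expansion_sum /=.
have -> : \sum_(n < `|k - h|.+1) a (h + n%:Z) * x ^ (h + n%:Z) =
    (\sum_(n < `|k - h|.+1) a (h + n%:Z) * x ^+ n) * x ^ h.
  rewrite mulr_suml; apply: eq_bigr => n _.
  by rewrite expfzDr// -exprnP mulrCA mulrC.
rewrite expfzDr// -invr_expz; have := expfz_neq0 h x0; have := expfz_neq0 k x0.
move: (x ^ h) (x ^ k) => u v v0 u0; field; exact/andP.
Unshelve. all: by end_near. Qed.

(** With both exponents equal to [h] the expansion sum is the single term [c * x ^ h], so a constant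
    coefficient sequence will do. *)
Lemma cvg_pivotal A h c : 0 < c -> A x / x ^ h @[x --> 0^'+] --> c ->
  pos_pivotal_expansion A h h (fun=> c).
Proof.
move=> c0 Ac; split => //; split => //.
rewrite -[X in _ --> X](subrr c).
apply: (near_eq_cvg_to (cvgB Ac (cvg_cst c))); near=> x.
have x0 : x != 0 by rewrite gt_eqF//; near: x; exact: nbhs_right_gt.
rewrite /expansion_sum subrr big_ord_recl big_ord0 /= !addr0.
by rewrite mulrBl mulfK// expfz_neq0.
Unshelve. all: by end_near. Qed.

(** If [h < 0], then [A x / x ^ h <= M * x ^ (- h)], whose right side tends to 0, against
    [c > 0]. *)
Lemma bounded_order_ge0 A h c M : 0 < c ->
  A x / x ^ h @[x --> 0^'+] --> c -> (\forall x \near 0^'+, A x <= M) -> 0 <= h.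
Proof.
move=> c0 Ac AM; rewrite leNgt; apply/negP => h0.
have : M * x ^ (- h) @[x --> (0 : R)^'+] --> M * ((- h == 0)%:R : R).
  by apply: cvgM; [exact: cvg_cst|apply: cvg_exprz_at_right0]; rewrite oppr_ge0 ltW.
rewrite oppr_eq0 lt_eqF// mulr0 => M0.
suff : c <= 0 by rewrite leNgt c0.
apply: ler_cvg_to Ac M0 _; near=> x.
have x0 : 0 < x by near: x; exact: nbhs_right_gt.
rewrite -invr_expz ler_pM2r ?invr_gt0 ?exprz_gt0//.
by near: x.
Unshelve. all: by end_near. Qed.

Lemma has_orderD A B :
  has_order A -> has_order B -> has_order (fun x => A x + B x).
Proof.
move=> [h [a [a0 Aa]]] [k [b [b0 Bb]]].
wlog hk : A B h k a b a0 b0 Aa Bb / h <= k.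
  move=> H; have [hk|/ltW kh] := leP h k; first exact: (H A B h k a b).
  apply: (@near_has_order (fun x => B x + A x)); last exact: (H B A k h b a).
  by near=> x; rewrite addrC.
(* The second constant contributes only when the exponents agree; both constants being positive,
   they cannot cancel. *)
exists h, (a + b * (k - h == 0)%:R); split.
  by case: eqP => _; rewrite ?mulr1 ?mulr0 ?addr0// addr_gt0.
have kh0 : 0 <= k - h by rewrite subr_ge0.
apply: (near_eq_cvg_to (cvgD Aa (cvgM Bb (cvg_exprz_at_right0 kh0)))); near=> x.
have x0 : x != 0 by rewrite gt_eqF//; near: x; exact: nbhs_right_gt.
rewrite /= expfzDr// -invr_expz mulrA mulfVK ?expfz_neq0//.
by rewrite mulrDl.
Unshelve. all: by end_near. Qed.

Lemma has_orderM A B :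
  has_order A -> has_order B -> has_order (fun x => A x * B x).
Proof.
move=> [h [a [a0 Aa]]] [k [b [b0 Bb]]]; exists (h + k), (a * b).
split; first exact: mulr_gt0.
apply: (near_eq_cvg_to (cvgM Aa Bb)); near=> x.
have x0 : x != 0 by rewrite gt_eqF//; near: x; exact: nbhs_right_gt.
by rewrite /= expfzDr// invfM mulrACA.
Unshelve. all: by end_near. Qed.

Lemma has_orderV A : has_order A -> has_order (fun x => (A x)^-1).
Proof.
move=> [h [a [a0 Aa]]]; exists (- h), a^-1; split; first by rewrite invr_gt0.
apply: (near_eq_cvg_to (cvgV (lt0r_neq0 a0) Aa)); near=> x.
by rewrite /= -invr_expz invrK invfM invrK.
Unshelve. all: by end_near. Qed.

Lemma zero_or_orderDl A B :
  has_order A -> zero_or_order B -> has_order (fun x => A x + B x).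
Proof.
move=> Ao [B0|]; last exact: has_orderD.
by apply: near_has_order Ao; apply: filterS B0 => x ->; rewrite addr0.
Qed.

Lemma zero_or_orderDr A B :
  zero_or_order A -> has_order B -> has_order (fun x => A x + B x).
Proof.
move=> [A0|Ao]; last exact: has_orderD.
by apply: near_has_order; apply: filterS A0 => x ->; rewrite add0r.
Qed.

Lemma zero_or_orderD A B :
  zero_or_order A -> zero_or_order B -> zero_or_order (fun x => A x + B x).
Proof.
move=> [A0|Ao] Bo; last by right; exact: zero_or_orderDl.
have [B0|Bo'] := Bo; last by right; apply: zero_or_orderDr => //; left.
by left; apply: filterS2 A0 B0 => x -> ->; rewrite addr0.
Qed.

Lemma zero_or_orderM A B :
  zero_or_order A -> zero_or_order B -> zero_or_order (fun x => A x * B x).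
Proof.
move=> [A0 _|Ao [B0|Bo]]; last by right; exact: has_orderM.
  by left; apply: filterS A0 => x ->; rewrite mul0r.
by left; apply: filterS B0 => x ->; rewrite mulr0.
Qed.

Lemma zero_or_order_sum (I : Type) (s : seq I) (c : pred I) (F : I -> R -> R) :
  (forall i, zero_or_order (F i)) ->
  zero_or_order (fun x => \sum_(i <- s | c i) F i x).
Proof.
move=> Fo; elim: s => [|i s IH].
  by left; apply: nearW => x; rewrite big_nil.
under eq_fun do rewrite big_cons.
by case: (c i) => //; exact: zero_or_orderD.
Qed.

End PowerOrder.

(** * Geometric and arithmetic-geometric series *)

Section Series.
Context {R : realType}.

Lemma nneseries_shift (f : nat -> \bar R) : (forall n, (0 <= f n)%E) ->
  (\sum_(n <oo) f n = f 0%N + \sum_(n <oo) f n.+1)%E.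
Proof.
move=> f0; rewrite nneseries_recl//; congr (_ + _)%E.
by rewrite -(@nneseries_addn _ f 1)//; apply: eq_eseriesr => n _; rewrite addn1.
Qed.

Lemma EFin_series (f : nat -> R) (l : R) : series f @ \oo --> l ->
  (\sum_(n <oo) (f n)%:E = l%:E)%E.
Proof.
move=> fl; apply: cvg_lim => //.
rewrite [X in X @ _](_ : _ = EFin \o series f); first exact: (cvg_comp _ _ fl).
by apply/funext => n; rewrite /= sumEFin.
Qed.

Lemma eseries_geometric (x : R) : 0 <= x < 1 ->
  (\sum_(n <oo) (x ^+ n)%:E = ((1 - x)^-1)%:E)%E.
Proof.
move=> /andP[x0 x1]; apply: EFin_series; rewrite -[X in _ --> X]mul1r.
rewrite [X in series X](_ : _ = geometric 1 x).
  by apply: cvg_geometric_series; rewrite ger0_norm.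
by apply/funext => n; rewrite /geometric /= mul1r.
Qed.

(** Partial sums of the derivative of the geometric series, with the denominator cleared. At [k = 0]
    the truncated [k.-1] is harmless because of the factor [k]. *)
Lemma sum_arithmetic_geometric (x : R) n :
  (1 - x) ^+ 2 * \sum_(k < n.+1) k%:R * x ^+ k.-1 =
  1 - n.+1%:R * x ^+ n * (1 - x) - x ^+ n.+1.
Proof.
elim: n => [|n IH]; first by rewrite big_ord_recr big_ord0 /= expr0; ring.
by rewrite big_ord_recr /= mulrDr IH -!natr1 !exprS; ring.
Qed.

Lemma eseries_arithmetic_geometric (x : R) : 0 <= x < 1 ->
  (\sum_(n <oo) (n%:R * x ^+ n.-1)%:E = (((1 - x) ^+ 2)^-1)%:E)%E.
Proof.
move=> /andP[x0 x1]; have y0 : 0 < 1 - x by rewrite subr_gt0.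
pose u n : R := n%:R * x ^+ n.-1.
have u0 n : 0 <= u n by rewrite mulr_ge0// exprn_ge0.
have uE n : series u n.+1 = (1 - u n.+1 * (1 - x) - x ^+ n.+1) / (1 - x) ^+ 2.
  apply: (mulfI (lt0r_neq0 (exprn_gt0 2 y0))).
  rewrite /series /= big_mkord sum_arithmetic_geometric.
  by rewrite [RHS]mulrC mulfVK// lt0r_neq0// exprn_gt0.
(* Convergence comes first, from monotonicity and the bound [(1 - x) ^- 2]. It forces [u n] to tend
   to 0, which removes the middle term of [uE] in the limit. *)
have ucvg : cvgn (series u).
  apply: nondecreasing_is_cvgn; first exact: nondecreasing_series.
  exists ((1 - x) ^- 2) => _ [[|n] _ <-].
    by rewrite /series /= big_geq// invr_ge0 exprn_ge0// ltW.
  rewrite uE -[leRHS]mul1r ler_pM2r ?invr_gt0 ?exprn_gt0//.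
  by rewrite -addrA gerDl -opprD oppr_le0 addr_ge0 ?exprn_ge0// mulr_ge0// ltW.
apply: EFin_series; rewrite -(cvg_shiftS (series u)).
suff lim : (1 - u n.+1 * (1 - x) - x ^+ n.+1) / (1 - x) ^+ 2 @[n --> \oo]
    --> (1 - 0 * (1 - x) - 0) / (1 - x) ^+ 2.
  move: lim; rewrite mul0r !subr0 mul1r.
  by rewrite [X in X @ _ --> _ -> _](_ : _ = fun n => series u n.+1)//; apply/funext.
apply: cvgM; last exact: cvg_cst.
apply: cvgB; first apply: cvgB; first exact: cvg_cst.
  apply: cvgM; last exact: cvg_cst.
  rewrite (cvg_shiftS u); exact: cvg_series_cvg_0.
by rewrite (cvg_shiftS (fun n => x ^+ n)); apply: cvg_expr; rewrite ger0_norm.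
Qed.

End Series.

(** * Expectations on an event and their tails *)

Section ProbabilityLemmas.
Context {d : measure_display} {T : measurableType d} {R : realType}.
Implicit Types (mu : probability T R) (A : set T) (f : T -> R).

Lemma cvg_fine_probability mu (F : nat -> set T) :
  (forall n, measurable (F n)) -> (forall n m, (n <= m)%N -> F n `<=` F m) ->
  fine (mu (F n)) @[n --> \oo] --> fine (mu (\bigcup_n F n)).
Proof.
move=> mF ndF; apply: fine_cvg; rewrite fineK ?fin_num_measure//; last first.
  exact: bigcup_measurable.
apply: nondecreasing_cvg_mu => //; first exact: bigcup_measurable.
by move=> n m nm; apply/subsetPset; exact: ndF.
Qed.

Lemma measurable_le_set f (t : R) : measurable_fun setT f ->
  measurable [set w | f w <= t].
Proof.
move=> mf; have := mf measurableT _ (measurable_itv `]-oo, t]).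
by rewrite setTI set_itvE.
Qed.

Lemma fine_probabilityD mu A f t : measurable A -> measurable_fun setT f ->
  mu (A `&` [set w | t < f w]) =
  (fine (mu A) - fine (mu (A `&` [set w | f w <= t])))%:E.
Proof.
move=> mA mf; have mle := measurable_le_set t mf.
rewrite EFinB !fineK ?fin_num_measure//; last exact: measurableI.
rewrite -measureD// ?ltey_eq ?fin_num_measure//.
congr (mu _); apply/seteqP; split=> w /= [Aw].
  by move=> tf; split => //; apply/negP; rewrite -ltNge.
by move/negP; rewrite -ltNge.
Qed.

(** Packages the product as a random variable, so that the tail formula for expectations applies to
    it. *)
Lemma indic_mul_RV mu A f : measurable A -> measurable_fun setT f ->
  exists X : {RV mu >-> R}, X = (fun w => \1_A w * f w) :> (T -> R).
Proof.
move=> mA mf; have mX : (fun w => \1_A w * f w) \in mfun.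
  by rewrite inE /=; apply: measurable_funM => //; exact: measurable_indic.
by exists (mfun_Sub mX).
Qed.

(** Outside [A] the product is 0, which does not exceed a nonnegative [t]. *)
Lemma ccdf_indic_mul mu A f (X : {RV mu >-> R}) t :
  X = (fun w => \1_A w * f w) :> (T -> R) -> 0 <= t ->
  ccdf X t = mu (A `&` [set w | t < f w]).
Proof.
move=> XE t0; rewrite /ccdf /distribution /pushforward XE; congr (mu _).
apply/seteqP; split=> w /=; rewrite in_itv/= andbT indicE.
  have [/set_mem Aw|_] := boolP (w \in A); first by rewrite mul1r.
  by rewrite mul0r ltNge t0.
by move=> [/mem_set -> tf]; rewrite mul1r.
Qed.

(* By the layer-cake formula, proportional tails give proportional expectations. *)
Lemma integral_indic_mul_scaled mu (nu : probability T R) A (B : set T) f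
    (g : T -> R) (c : R) :
  measurable A -> measurable B ->
  measurable_fun setT f -> measurable_fun setT g ->
  (forall w, 0 <= f w) -> (forall w, 0 <= g w) -> 0 <= c ->
  (forall t, 0 <= t -> mu (A `&` [set w | t < f w]) =
     (c%:E * nu (B `&` [set w | (t < g w)%R]))%E) ->
  (\int[mu]_w (\1_A w * f w)%:E = c%:E * \int[nu]_w (\1_B w * g w)%:E)%E.
Proof.
move=> mA mB mf mg f0 g0 c0 cfg.
have [X XE] := indic_mul_RV mu mA mf; have [Z ZE] := indic_mul_RV nu mB mg.
have X0 w : 0 <= X w by rewrite XE mulr_ge0.
have Z0 w : 0 <= Z w by rewrite ZE mulr_ge0.
have := ge0_expectation_ccdf X0; have := ge0_expectation_ccdf Z0.
rewrite unlock XE ZE => -> ->.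
rewrite -ge0_integralZl//; last first.
  by apply: measurable_funTS; exact: ccdf_measurable.
apply: eq_integral => t; rewrite inE /= in_itv/= andbT => t0.
by rewrite (ccdf_indic_mul XE)// (ccdf_indic_mul ZE)// cfg.
Qed.

End ProbabilityLemmas.

(** * Path probabilities and path expectations of a Markov renewal process *)

Section MarkovRenewal.
Variables (R : realType) (N : nat) (d : measure_display).
Variables (T : R -> measurableType d).
Variables (P : forall eps, 'I_N -> probability (T eps) R).
Variables (eta_ : forall eps, nat -> T eps -> 'I_N).
Variables (kappa_ : forall eps, nat -> T eps -> R).
Arguments P : clear implicits.
Arguments eta_ : clear implicits.
Arguments kappa_ : clear implicits.
Hypothesis mrp : MRP_family P eta_ kappa_.
Variable eps : R.
Hypothesis eps01 : 0 < eps <= 1.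

Local Notation eta := (eta_ eps).
Local Notation kappa := (kappa_ eps).
Local Notation Q := (kerQ P eta_ kappa_ eps).
Local Notation p := (kerp P eta_ eps).
Local Notation e := (kere P eta_ kappa_ eps).

Lemma measurable_eta n j : measurable [set w | eta n w = j].
Proof. by have [[]] := mrp eps01. Qed.

Lemma measurable_kappa n : measurable_fun setT (kappa n).
Proof. by have [[]] := mrp eps01. Qed.

Lemma kappa_ge0 n w : 0 <= kappa n w.
Proof. by have [] := mrp eps01. Qed.

(* The bound [t k] is imposed only where [b k] holds: [b k = false] encodes
   [t k = +oo]. *)
Definition path_le n (s : nat -> 'I_N) (b : pred nat) (t : nat -> R) :
    set (T eps) :=
  [set w | forall k, (0 < k <= n)%N -> eta k w = s k /\ (b k -> kappa k w <= t k)].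

Definition path_event n s := path_le n s pred0 (fun=> 0).

Lemma measurable_path_le n s b t : measurable (path_le n s b t).
Proof.
rewrite [X in measurable X](_ : _ = \bigcap_(k in [set k | (0 < k <= n)%N])
  ([set w | eta k w = s k] `&` [set w | b k -> kappa k w <= t k])).
  apply: bigcap_measurableType => k _; apply: measurableI.
    exact: measurable_eta.
  case: (b k) => /=; last first.
    by rewrite [X in measurable X](_ : _ = setT)//; apply/seteqP; split.
  rewrite [X in measurable X](_ : _ = [set w | kappa k w <= t k]).
    exact/measurable_le_set/measurable_kappa.
  by apply/seteqP; split => w /=; [apply|].
by apply/seteqP; split => w /= H k /H.
Qed.

Lemma measurable_path n s : measurable (path_event n s).
Proof. exact: measurable_path_le. Qed.

Lemma kerp_ge0 i j : 0 <= p i j.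
Proof. exact/fine_ge0/measure_ge0. Qed.

(** Continuity from below: [kappa 1] is finite, so the events with integer bounds increase to the
    event without bound. This identifies [p] with the value of [Q] at infinity. *)
Lemma cvg_kerQ i j : Q i j n%:R @[n --> \oo] --> p i j.
Proof.
rewrite /kerQ /kerp.
rewrite [X in _ --> fine (P eps i X)](_ : _ =
    \bigcup_n [set w | eta 1 w = j /\ kappa 1 w <= n%:R]); last first.
  apply/seteqP; split=> [w /= wj|w [n _ []]//].
  by exists (Num.truncn (kappa 1 w)).+1 => //=; split => //; rewrite ltW// truncnS_gt.
apply: cvg_fine_probability => [n|n m nm w /= [-> kn]].
  apply: measurableI; first exact: measurable_eta.
  exact/measurable_le_set/measurable_kappa.
by split => //; rewrite (le_trans kn)// ler_nat.
Qed.

(** The product formula of [MRP_family] bounds every holding time. The free ones are bounded by [m],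
    and [m] tends to infinity on both sides. *)
Lemma path_le_prob n s b t :
  fine (P eps (s 0%N) (path_le n s b t)) =
  \prod_(1 <= k < n.+1)
     if b k then Q (s k.-1) (s k) (t k) else p (s k.-1) (s k).
Proof.
pose u m k : R := if b k then t k else m%:R.
pose F m : set (T eps) := [set w | forall k, (0 < k <= n)%N ->
  eta k w = s k /\ kappa k w <= u m k].
have FE m : F m = path_le n s predT (u m).
  by apply/seteqP; split => w H k /H[-> H']; split => //; exact: H'.
have FU : path_le n s b t = \bigcup_m F m.
  apply/seteqP; split => w /=; last first.
    by move=> [m _ Fm] k /Fm[-> km]; split => // bk; move: km; rewrite /u bk.
  (* Only finitely many holding times matter, so one integer dominates them all. *)
  move=> H; exists (\max_(k < n.+1) (Num.truncn (kappa k w)).+1)%N => // k kn.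
  have [-> Hk] := H _ kn; split => //; rewrite /u; case: ifP => [/Hk//|_].
  move: kn => /andP[_ kn]; rewrite -ltnS in kn.
  rewrite (le_trans (ltW (truncnS_gt (kappa k w))))// ler_nat.
  exact: (leq_bigmax (Ordinal kn)).
have : fine (P eps (s 0%N) (F m)) @[m --> \oo] -->
    fine (P eps (s 0%N) (path_le n s b t)).
  rewrite FU; apply: cvg_fine_probability => [m|m m' mm' w Fm k kn].
    by rewrite FE; exact: measurable_path_le.
  have [-> km] := Fm _ kn; split => //; rewrite (le_trans km)// /u.
  by case: (b k) => //; rewrite ler_nat.
have [_ _ _ _ Fprob] := mrp eps01.
under eq_fun do rewrite Fprob.
move/cvg_unique; apply => //; apply: cvg_big => [|k _]; first exact: mul_continuous.
rewrite /u; case: (b k); [exact: cvg_cst|exact: cvg_kerQ].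
Qed.

Lemma path_prob n s :
  P eps (s 0%N) (path_event n s) = (\prod_(1 <= k < n.+1) p (s k.-1) (s k))%:E.
Proof.
by rewrite -[LHS]fineK ?fin_num_measure//; [rewrite path_le_prob|exact: measurable_path].
Qed.

Lemma kereE i j :
  e i j = (\int[P eps i]_w (\1_[set w | eta 1 w = j] w * kappa 1 w)%:E)%E.
Proof.
apply: eq_integral => w _; congr (_ * _)%:E; rewrite indicE; congr (nat_of_bool _)%:R.
by apply/eqP/idP; rewrite inE.
Qed.

Lemma kere_ge0 i j : (0 <= e i j)%E.
Proof. by apply: integral_ge0 => w _; rewrite lee_fin mulr_ge0// kappa_ge0. Qed.

(** On a prescribed path the tail event of [kappa k] changes only the factor of step [k]; the other
    factors form the constant that scales the one-step tail. *)
Lemma path_integral n s k : (0 < k <= n)%N ->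
  (\int[P eps (s 0%N)]_w (\1_(path_event n s) w * kappa k w)%:E =
   (\prod_(1 <= l < n.+1 | l != k) p (s l.-1) (s l))%:E * e (s k.-1) (s k))%E.
Proof.
move=> kn; rewrite kereE; apply: integral_indic_mul_scaled.
- exact: measurable_path.
- exact: measurable_eta.
- exact: measurable_kappa.
- exact: measurable_kappa.
- exact: kappa_ge0.
- exact: kappa_ge0.
- by apply: prodr_ge0 => l _; exact: kerp_ge0.
move=> t t0; rewrite !fine_probabilityD//; first last.
- exact: measurable_kappa.
- exact: measurable_path.
- exact: measurable_kappa.
- exact: measurable_eta.
rewrite path_prob -EFinM; congr _%:E.
(* Passing to the complement of the tail leaves a path event with a bound at step [k] alone. *)
have -> : path_event n s `&` [set w | kappa k w <= t] =
    path_le n s (pred1 k) (fun=> t).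
  apply/seteqP; split => w /=.
    by move=> [H kt] l /H[-> _]; split => // /eqP ->.
  by move=> H; split => [l /H[]//|]; have [_] := H _ kn; apply; rewrite /= eqxx.
rewrite path_le_prob /=.
have kin : k \in index_iota 1 n.+1 by rewrite mem_index_iota.
rewrite !(bigD1_seq k)//= ?iota_uniq//= eqxx.
rewrite [X in _ - _ * X](eq_bigr (fun l => p (s l.-1) (s l))); last first.
  by move=> l /negbTE ->.
by rewrite -mulrBl mulrC.
Qed.

Lemma kerp_sum1 i : \sum_j p i j = 1.
Proof.
apply: EFin_inj; rewrite -sumEFin.
rewrite (eq_bigr (fun j => P eps i [set w | eta 1 w = j])); last first.
  by move=> j _; rewrite fineK// fin_num_measure//; exact: measurable_eta.
rewrite -measure_bigsetU_ord//; last first.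
- by move=> j k _ _ [w [/= -> ->]].
- by move=> j; exact: measurable_eta.
rewrite -(probability_setT (P eps i)); congr (P eps i _).
by apply/seteqP; split => w // _; rewrite (bigD1 (eta 1 w))//=; left.
Qed.

(** The tails lie in a null event, so the tail comparison applies with scaling constant 0. *)
Lemma kerp0_kere0 i j : p i j = 0 -> e i j = 0%E.
Proof.
move=> p0; rewrite kereE -[RHS](mul0e (e i j)) kereE.
apply: integral_indic_mul_scaled => //; try exact: measurable_eta;
  try exact: measurable_kappa; try exact: kappa_ge0.
move=> t t0; rewrite mul0e; apply/eqP; rewrite -measure_le0.
have -> : 0%E = P eps i [set w | eta 1 w = j].
  by rewrite -[RHS]fineK ?fin_num_measure//; [rewrite -/(p i j) p0|exact: measurable_eta].
apply: le_measure; rewrite ?inE; last exact: subIsetl.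
- apply: measurableI; first exact: measurable_eta.
  have := measurableC (measurable_le_set t (measurable_kappa 1)).
  by congr (measurable _); apply/seteqP; split=> w /=; rewrite ltNge => /negP.
- exact: measurable_eta.
Qed.

(** * Excursions through the removed state *)

Section Reduction.
Variable r : 'I_N.

(** The path i, r, ..., r, j with [n] steps. Path events constrain only positive indices; the value
    at 0 fixes the initial law and the first transition. *)
Definition exit_path (i j : 'I_N) n k : 'I_N :=
  if k == 0%N then i else if (k < n)%N then r else j.

Lemma first_exitE i j n :
  [set w | first_exit eta_ r n.+1 j w] = path_event n.+1 (exit_path i j n.+1).
Proof.
apply/seteqP; split => w /=.
  move=> /and3P[_ /eqP nj /allP nr] k /andP[k0]; split => //.
  rewrite /exit_path gtn_eqF//; move: b; rewrite leq_eqVlt => /predU1P[->|kn].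
    by rewrite ltnn.
  by rewrite kn; apply/eqP/nr; rewrite mem_iota k0 add1n.
move=> H; apply/and3P; split => //.
  by have [-> _] := H n.+1 (leqnn _); rewrite /exit_path/= ltnn.
apply/allP => k; rewrite mem_iota add1n => /andP[k0 kn].
have [|-> _] := H k; first by rewrite k0 ltnW.
by rewrite /exit_path gtn_eqF// kn.
Qed.

Lemma indic_first_exit i j n w :
  (first_exit eta_ r n.+1 j w)%:R = \1_(path_event n.+1 (exit_path i j n.+1)) w :> R.
Proof.
rewrite -first_exitE indicE; congr (nat_of_bool _)%:R.
by apply/idP/idP; rewrite inE.
Qed.

(** The steps are one entry into [r], [n] loops at [r] numbered 2 to [n + 1], and one departure to
    [j]. The predicate [c] serves to keep all factors for probabilities, or all but one for
    expectations. *)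
Lemma prod_exit_path (g : 'I_N -> 'I_N -> R) (c : pred nat) i j n :
  \prod_(1 <= k < n.+3 | c k)
     g (exit_path i j n.+2 k.-1) (exit_path i j n.+2 k) =
  (if c 1%N then g i r else 1) * g r r ^+ count c (iota 2 n) *
  (if c n.+2 then g r j else 1).
Proof.
rewrite big_mkcond big_ltn// big_nat_recr//= mulrA; congr (_ * _ * _).
- rewrite -iter_mulr_1 -big_const_seq [RHS]big_mkcond.
  have -> : iota 2 n = index_iota 2 n.+2 by rewrite /index_iota !subSS subn0.
  apply: eq_big_nat => k /andP[k2 kn]; rewrite /exit_path kn.
  by case: k k2 kn => [|[|k]]//= _ kn; rewrite (ltnW kn).
- by rewrite /exit_path ltnSn ltnn.
Qed.

Lemma count_predC1_iota k m n :
  count (predC1 k) (iota m n) = (n - (m <= k < m + n))%N.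
Proof.
have := count_predC (pred1 k) (iota m n).
by rewrite size_iota count_uniq_mem ?iota_uniq// mem_iota => {2}<-; rewrite addKn.
Qed.

Lemma exit1_prob i j : P eps i [set w | first_exit eta_ r 1 j w] = (p i j)%:E.
Proof. by rewrite (first_exitE i) (path_prob _ (exit_path i j 1)) big_nat1. Qed.

Lemma exitSS_prob i j n : P eps i [set w | first_exit eta_ r n.+2 j w] =
  (p i r * p r j * p r r ^+ n)%:E.
Proof.
rewrite (first_exitE i) (path_prob _ (exit_path i j n.+2)) prod_exit_path.
by rewrite count_predT size_iota mulrAC.
Qed.

Lemma measurable_first_exit j n :
  measurable [set w : T eps | first_exit eta_ r n j w].
Proof.
(* The event does not involve the initial state, so [j] stands in for it. *)
case: n => [|n]; last by rewrite (first_exitE j); exact: measurable_path.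
by rewrite [X in measurable X](_ : _ = set0)//; apply/seteqP; split.
Qed.

Lemma redpE i j : j != r -> p r r < 1 ->
  redp P eta_ r eps i j = p i j + p i r * p r j / (1 - p r r).
Proof.
move=> jr pr1; have pr01 : 0 <= p r r < 1 by rewrite kerp_ge0.
have c0 : 0 <= p i r * p r j by rewrite mulr_ge0 ?kerp_ge0.
rewrite /redp [X in P eps i X](_ : _ =
    \bigcup_n [set w | first_exit eta_ r n j w]); last first.
  by apply/seteqP; split => [w [n]|w [n _]]; exists n.
rewrite measure_semi_bigcup; first last.
- by apply: bigcup_measurable => n _; exact: measurable_first_exit.
(* Two different exit times would put the chain both at [j] and at [r] at the earlier one. *)
- move=> m n _ _ [w [/= /and3P[m0 /eqP mj mr] /and3P[n0 /eqP nj nr]]].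
  apply/eqP; rewrite eqn_leq; apply/andP; split; rewrite leqNgt; apply/negP => lt.
    have : n \in iota 1 m.-1 by rewrite mem_iota; lia.
    by move/(allP mr); rewrite nj (negbTE jr).
  have : m \in iota 1 n.-1 by rewrite mem_iota; lia.
  by move/(allP nr); rewrite mj (negbTE jr).
- by move=> n; exact: measurable_first_exit.
rewrite nneseries_shift// nneseries_shift//= exit1_prob.
rewrite [X in P eps i X](_ : _ = set0) ?measure0 ?add0e; last first.
  by apply/seteqP; split.
under eq_eseriesr do rewrite exitSS_prob EFinM.
rewrite nneseriesZl ?eseries_geometric//.
by move=> n _; rewrite lee_fin exprn_ge0// kerp_ge0.
Qed.

Lemma exit_integral i j n :
  (\int[P eps i]_w ((first_exit eta_ r n.+1 j w)%:R * sum_kappa kappa_ n.+1 w)%:E =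
  \sum_(1 <= k < n.+2) (\prod_(1 <= l < n.+2 | l != k)
    p (exit_path i j n.+1 l.-1) (exit_path i j n.+1 l))%:E *
    e (exit_path i j n.+1 k.-1) (exit_path i j n.+1 k))%E.
Proof.
transitivity (\int[P eps i]_w (\sum_(k <- index_iota 1 n.+2)
    (\1_(path_event n.+1 (exit_path i j n.+1)) w * kappa k w)%:E))%E.
  apply: eq_integral => w _; rewrite sumEFin -mulr_sumr; congr (_ * _)%:E.
  exact: indic_first_exit.
rewrite ge0_integral_sum//; first last.
- by move=> k w _; rewrite lee_fin mulr_ge0// kappa_ge0.
- move=> k; apply/measurable_EFinP/measurable_funM; last exact: measurable_kappa.
  exact/measurable_indic/measurable_path.
apply: eq_big_nat => k kn; exact: (path_integral (exit_path i j n.+1)).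
Qed.

Lemma redp_le1 i j : redp P eta_ r eps i j <= 1.
Proof.
have mE : measurable [set w : T eps | exists n, first_exit eta_ r n j w].
  rewrite [X in measurable X](_ : _ =
      \bigcup_n [set w | first_exit eta_ r n j w]).
    by apply: bigcup_measurable => n _; exact: measurable_first_exit.
  by apply/seteqP; split => [w [n]|w [n _]]; exists n.
by rewrite -lee_fin fineK ?fin_num_measure// probability_le1.
Qed.

Lemma prob_kappa1_0 i : (forall j, Q i j 0 = 0) ->
  P eps i [set w | kappa 1 w <= 0] = 0%E.
Proof.
move=> Q0.
have mj j : measurable [set w | eta 1 w = j /\ kappa 1 w <= 0].
  apply: measurableI; first exact: measurable_eta.
  exact/measurable_le_set/measurable_kappa.
rewrite [X in P eps i X](_ : _ =
    \big[setU/set0]_(j < N) [set w | eta 1 w = j /\ kappa 1 w <= 0]).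
  rewrite measure_bigsetU_ord//; last by move=> j k _ _ [w [/= [-> _] [-> _]]].
  by rewrite big1// => j _; rewrite -[LHS]fineK ?fin_num_measure// -/(Q i j 0) Q0.
apply/seteqP; split => w /=; first by rewrite (bigD1 (eta 1 w))//=; left.
by apply: (big_ind (fun A => A w -> kappa 1 w <= 0)) => // [A B IA IB []|j _ []].
Qed.

(** An exit takes at least one step and holding times are nonnegative, so the reduced time dominates
    [kappa 1], which is almost surely positive. *)
Lemma redQ0 i j : (forall k, Q i k 0 = 0) -> redQ P eta_ kappa_ r eps i j 0 = 0.
Proof.
move=> Q0; rewrite /redQ [X in fine X](_ : _ = 0%E)//; apply/eqP.
rewrite -measure_le0 -(prob_kappa1_0 Q0); apply: le_measure; rewrite ?inE.
- rewrite [X in measurable X](_ : _ = \bigcup_n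
      ([set w | first_exit eta_ r n j w] `&` [set w | sum_kappa kappa_ n w <= 0])).
    apply: bigcup_measurable => n _; apply: measurableI.
      exact: measurable_first_exit.
    apply: measurable_le_set; apply: measurable_sum => k; exact: measurable_kappa.
  by apply/seteqP; split => [w [n]|w [n _]]; exists n.
- exact/measurable_le_set/measurable_kappa.
move=> w /= [n [/and3P[n0 _ _]]]; apply: le_trans.
by rewrite /sum_kappa big_ltn// lerDl sumr_ge0// => k _; exact: kappa_ge0.
Qed.

Hypothesis kere_fin : forall i j, (e i j < +oo)%E.
Local Notation er i j := (fine (e i j)).

Lemma kereK i j : e i j = (er i j)%:E.
Proof. by rewrite fineK// ge0_fin_numE ?kere_ge0. Qed.

(** The entry and departure times are each weighted by all [n] loops; each loop time is weighted by
    the other [n - 1]. For [n = 0] the loop term vanishes through its factor [n]. *)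
Lemma exitSS_integral i j n :
  (\int[P eps i]_w ((first_exit eta_ r n.+2 j w)%:R * sum_kappa kappa_ n.+2 w)%:E =
  ((er i r * p r j + p i r * er r j) * p r r ^+ n)%:E +
  (p i r * p r j * er r r * (n%:R * p r r ^+ n.-1))%:E)%E.
Proof.
rewrite exit_integral; under eq_bigr do rewrite kereK -EFinM.
rewrite sumEFin -EFinD; congr _%:E.
(* The omitted indices 1 and [n + 2] lie outside the loop range, so all [n] loop factors remain. *)
rewrite big_ltn// big_nat_recr//= !prod_exit_path !count_predC1_iota/=.
rewrite add2n ltnn !subn0 eqxx.
(* Every intermediate step goes from [r] to [r], so these [n] terms coincide. *)
rewrite (eq_big_nat _ _
    (F2 := fun=> p i r * p r r ^+ n.-1 * p r j * er r r)) => [|k /andP[k2 kn]].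
  rewrite /exit_path /= ltnSn ltnn.
  by rewrite sumr_const_nat !subSS subn0 -mulr_natl; ring.
rewrite prod_exit_path count_predC1_iota add2n k2 kn subn1 /=.
have -> : exit_path i j n.+2 k.-1 = r.
  by case: k k2 kn => [|[|k]]// _ kn; rewrite /exit_path /= (ltnW kn).
have -> : exit_path i j n.+2 k = r.
  by case: k k2 kn => [|k]// _ kn; rewrite /exit_path /= kn.
by rewrite (gtn_eqF kn) (ltn_eqF k2).
Qed.

(** Nonnegativity allows the integral and the sum over exit times to be exchanged. Entry and
    departure times then give a geometric series, loop times an arithmetic-geometric one, whence the
    squared denominator. *)
Lemma redeE i j : p r r < 1 -> rede P eta_ kappa_ r eps i j =
  (er i j + (er i r * p r j + p i r * er r j) / (1 - p r r) +
   p i r * p r j * er r r / (1 - p r r) ^+ 2)%:E.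
Proof.
move=> pr1; have pr01 : 0 <= p r r < 1 by rewrite kerp_ge0.
have er0 k l : 0 <= er k l by exact/fine_ge0/kere_ge0.
have p0 := kerp_ge0.
have f0 n (w : T eps) : (0 <= ((first_exit eta_ r n j w)%:R * sum_kappa kappa_ n w)%:E)%E.
  by rewrite lee_fin; apply: mulr_ge0 => //; apply: sumr_ge0 => k _; exact: kappa_ge0.
rewrite /rede integral_nneseries//; last first.
  move=> n; apply/measurable_EFinP/measurable_funM; last first.
    by apply: measurable_sum => k; exact: measurable_kappa.
  have := measurable_indic (D := setT) (R := R) (measurable_first_exit j n).
  congr measurable_fun; apply/funext => w; rewrite indicE; congr (nat_of_bool _)%:R.
  by apply/idP/idP; rewrite inE.
rewrite nneseries_shift; last by move=> n; exact: integral_ge0.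
rewrite nneseries_shift; last by move=> n; exact: integral_ge0.
rewrite exit_integral big_nat1 big_mkcond big_nat1 /= mul1e.
rewrite [X in (X + _)%E](_ : _ = 0%E) ?add0e; last first.
  by apply: integral0_eq => w _; rewrite mul0r.
under eq_eseriesr do rewrite exitSS_integral.
rewrite nneseriesD; first last.
- by move=> n _ _; rewrite lee_fin !(mulr_ge0, exprn_ge0).
- by move=> n _ _; rewrite lee_fin !(mulr_ge0, addr_ge0, exprn_ge0).
under eq_eseriesr do rewrite EFinM.
under [X in (_ + (_ + X))%E]eq_eseriesr do rewrite EFinM.
rewrite !nneseriesZl; first last.
- by move=> n _; rewrite lee_fin exprn_ge0.
- by move=> n _; rewrite lee_fin mulr_ge0// exprn_ge0.
rewrite eseries_geometric// eseries_arithmetic_geometric//.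
by rewrite kereK -!EFinM -!EFinD addrA.
Qed.

End Reduction.

End MarkovRenewal.

(** * Walks in the reduced transition graph *)

Section ReducedPaths.
Variables (N : nat) (Y : 'I_N -> {set 'I_N}).

Definition walk (Z : 'I_N -> {set 'I_N}) (n : nat) (l : nat -> 'I_N) :=
  forall k, (k < n)%N -> l k.+1 \in Z (l k).

Lemma in_redY r i j :
  (j \in redY Y r i) = (j != r) && ((j \in Y i) || (r \in Y i) && (j \in Y r)).
Proof. by rewrite !inE -andb_orl andbC orbC. Qed.

(** The induction needs walks that currently sit at [r]; then [i] records the last state outside
    [r], from which [r] is reachable in one step. *)
Lemma redY_walk r i j n l : i != r -> j != r -> (0 < n)%N ->
  l 0%N = i \/ l 0%N = r /\ r \in Y i -> l n = j -> walk Y n l ->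
  exists n' l', [/\ (0 < n')%N, l' 0%N = i, l' n' = j & walk (redY Y r) n' l'].
Proof.
elim: n i l => // n IH i l ir jr _ li lj lY.
have l1 : l 1%N \in Y i \/ r \in Y i /\ l 1%N \in Y r.
  by have := lY 0%N isT; case: li => [->|[-> ri]] ?; [left|right].
have [n0|n0] := posnP n.
  exists 1%N, (fun k => if k == 0%N then i else j); split => // -[|//] _.
  rewrite in_redY/= jr /= -lj n0.
  by case: l1 => [->//|[-> ->]]; rewrite orbT.
have lSY : walk Y n (l \o S) by move=> k kn; exact: lY.
(* A move to [r] makes no reduced step and keeps [i]; any other move becomes one reduced step from
   [i]. *)
have [l1r|l1r] := eqVneq (l 1%N) r.
  apply: (IH i (l \o S)) => //; right; split => //.
  by case: l1 => [|[]//]; rewrite l1r.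
have [|n' [l' [n'0 l'0 l'n l'Y]]] := IH (l 1%N) (l \o S) l1r jr n0 _ lj lSY.
  by left.
exists n'.+1, (fun k => if k is k'.+1 then l' k' else i); split => // -[|k] kn /=.
  by rewrite l'0 in_redY l1r /=; case: l1 => [->//|[-> ->]]; rewrite orbT.
exact: l'Y.
Qed.

(** The first departure from [r] provides the state. Applied to an irreducible graph, this is what
    makes [p r r < 1]. *)
Lemma walk_leaves r j n l : j != r -> l 0%N = r -> l n = j -> walk Y n l ->
  exists2 k, k != r & k \in Y r.
Proof.
move=> jr; elim: n l => [|n IH] l l0 ln lY; first by rewrite -ln l0 eqxx in jr.
have [l1|l1] := eqVneq (l 1%N) r.
  by apply: (IH (l \o S)) => // k kn; exact: lY.
by exists (l 1%N) => //; rewrite -l0; exact: lY.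
Qed.

End ReducedPaths.

(** * Verification of the five conditions for the reduced process *)

Theorem theorem3 (R : realType) (N : nat) (d : measure_display)
  (T : R -> measurableType d)
  (P : forall eps, 'I_N -> probability (T eps) R)
  (eta_ : forall eps, nat -> T eps -> 'I_N)
  (kappa_ : forall eps, nat -> T eps -> R)
  (eps0 : R) (Y : 'I_N -> {set 'I_N}) (r : 'I_N) :
  0 < eps0 <= 1 ->
  MRP_family P eta_ kappa_ ->
  condsABCDE [set: 'I_N] Y (kerQ P eta_ kappa_) (kerp P eta_) (kere P eta_ kappa_) eps0 ->
  condsABCDE [set~ r] (redY Y r) (redQ P eta_ kappa_ r) (redp P eta_ r)
    (rede P eta_ kappa_ r) eps0.
Proof.
move=> /andP[eps0_gt0 eps0_le1] mrp [[_ [Ypos Ywalk]] Q0 efin pexp eexp].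
pose p := kerp P eta_; pose er x i j := fine (kere P eta_ kappa_ x i j).
have eps01 x : 0 < x <= eps0 -> 0 < x <= 1.
  by move=> /andP[-> /le_trans]; exact.
have p_gt0 x : 0 < x <= eps0 -> forall i j, j \in Y i -> 0 < p x i j.
  by move=> xe i j; apply: (Ypos x xe i j _ _).1; rewrite inE.
have p_eq0 x : 0 < x <= eps0 -> forall i j, j \notin Y i -> p x i j = 0.
  by move=> xe i j; apply: (Ypos x xe i j _ _).2; rewrite inE.
have p_ge0 x i j : 0 <= p x i j by exact: kerp_ge0.
have e_fin x : 0 < x <= eps0 -> forall i j, (kere P eta_ kappa_ x i j < +oo)%E.
  by move=> xe i j; apply: efin => //; rewrite inE.
have near_eps : \forall x \near 0^'+, 0 < x <= eps0.
  apply: filterS2 (nbhs_right_gt 0) (nbhs_right_le eps0_gt0) => x -> //.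
have p_order i j : j \in Y i -> has_order (fun x => p x i j).
  move=> ji; have [|||h [k [a [_ piv]]]] := pexp i j; rewrite ?inE//.
  exact: pivotal_has_order piv.
have e_order i j : j \in Y i -> has_order (fun x => er x i j).
  move=> ji; have [|||h [k [a piv]]] := eexp i j; rewrite ?inE//.
  exact: pivotal_has_order piv.
have p_zo i j : zero_or_order (fun x => p x i j).
  have [/p_order|ji] := boolP (j \in Y i); first by right.
  by left; apply: filterS near_eps => x xe; exact: p_eq0.
have e_zo i j : zero_or_order (fun x => er x i j).
  have [/e_order|ji] := boolP (j \in Y i); first by right.
  left; apply: filterS near_eps => x xe.
  by rewrite /er kerp0_kere0//; [exact: eps01|exact: p_eq0].
have exit_r i : i != r -> exists2 k, k != r & k \in Y r.
  move=> ir; have [||n [l [_ l0 ln lY]]] := Ywalk r i; rewrite ?inE//.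
  exact: walk_leaves ir l0 ln lY.
have subp x : 0 < x <= eps0 -> 1 - p x r r = \sum_(k | k != r) p x r k.
  by move=> /eps01 x01; rewrite -(kerp_sum1 mrp x01 r) (bigD1 r)//= addrAC subrr add0r.
have prr_lt1 x i : 0 < x <= eps0 -> i != r -> p x r r < 1.
  move=> xe /exit_r[k kr kY]; rewrite -subr_gt0 subp// (bigD1 k)//=.
  by rewrite ltr_wpDr ?p_gt0// sumr_ge0.
(* Isolating a state [k] of [Y r] other than [r] gives the sum a term of exact order; the remaining
   terms may vanish. *)
have subp_order i : i != r -> has_order (fun x => (1 - p x r r)^-1).
  move=> /exit_r[k kr kY]; apply: has_orderV.
  apply: (@near_has_order _
    (fun x => p x r k + \sum_(j | (j != r) && (j != k)) p x r j)).
    by apply: filterS near_eps => x xe; rewrite subp// [RHS](bigD1 k).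
  by apply: zero_or_orderDl; [exact: p_order|exact: zero_or_order_sum].
have redp_E x i j : 0 < x <= eps0 -> i != r -> j != r ->
    redp P eta_ r x i j = p x i j + p x i r * p x r j / (1 - p x r r).
  move=> xe ir jr; apply: (redpE mrp (eps01 _ xe)) => //; exact: prr_lt1 ir.
have rede_E x i j : 0 < x <= eps0 -> i != r -> rede P eta_ kappa_ r x i j =
    (er x i j + (er x i r * p x r j + p x i r * er x r j) / (1 - p x r r) +
     p x i r * p x r j * er x r r / (1 - p x r r) ^+ 2)%:E.
  move=> xe ir; apply: (redeE mrp (eps01 _ xe)); first exact: e_fin.
  exact: prr_lt1 ir.
split.
- split; [|split].
  + by move=> i _; apply/fintype.subsetP => j; rewrite in_redY !inE => /andP[].
  + move=> x xe i j; rewrite !finset.in_setC1 => ir jr.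
    rewrite in_redY jr/= redp_E//.
    have q_gt0 : 0 < (1 - p x r r)^-1 by rewrite invr_gt0 subr_gt0 (prr_lt1 _ i).
    split.
      move=> /orP[ji|/andP[ri jY]].
        by rewrite ltr_wpDr ?p_gt0// !mulr_ge0// ltW.
      by rewrite ltr_wpDl// !mulr_gt0// p_gt0.
    rewrite negb_or negb_and => /andP[ji /orP[ri|jY]].
      by rewrite p_eq0// (p_eq0 _ _ i r)// !mul0r addr0.
    by rewrite p_eq0// (p_eq0 _ _ r j)// mulr0 mul0r addr0.
  + move=> i j; rewrite !finset.in_setC1 => ir jr.
    have [||n [l [n0 l0 ln lY]]] := Ywalk i j; rewrite ?inE//.
    by apply: (redY_walk ir jr n0 _ ln lY); left.
- move=> x xe i j _ _; apply: (redQ0 mrp (eps01 _ xe)) => k.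
  by apply: Q0; rewrite ?inE.
- by move=> x xe i j; rewrite finset.in_setC1 => ir _; rewrite rede_E// ltry.
- move=> i j; rewrite finset.in_setC1 => ir _; rewrite in_redY => /andP[jr jY].
  have : has_order (fun x => redp P eta_ r x i j).
    apply: (@near_has_order _
        (fun x => p x i j + p x i r * p x r j * (1 - p x r r)^-1)).
      by apply: filterS near_eps => x xe; rewrite redp_E.
    have q_order := subp_order i ir.
    (* The direct transition or the excursion through [r] supplies the exact order; the other
       summand may be zero. *)
    case/orP: jY => [ji|/andP[ri jY]].
      apply: zero_or_orderDl; first exact: p_order.
      by apply: zero_or_orderM; [exact: zero_or_orderM|right].
    apply: zero_or_orderDr => //; apply: has_orderM => //.
    by apply: has_orderM; exact: p_order.
  move=> [h [c [c0 lim]]]; exists h, h, (fun=> c); split; last exact: cvg_pivotal.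
  (* A probability is at most 1, which rules out a negative leading exponent. *)
  apply: (bounded_order_ge0 (M := 1) c0 lim).
  by apply: filterS near_eps => x /eps01 x01; exact: (redp_le1 mrp).
- move=> i j; rewrite finset.in_setC1 => ir _; rewrite in_redY => /andP[jr jY].
  have : has_order (fun x => fine (rede P eta_ kappa_ r x i j)).
    apply: (@near_has_order _ (fun x => er x i j +
        (er x i r * p x r j + p x i r * er x r j) * (1 - p x r r)^-1 +
        p x i r * p x r j * er x r r * ((1 - p x r r)^-1 * (1 - p x r r)^-1))).
      apply: filterS near_eps => x xe; rewrite rede_E//=.
      by rewrite expr2 invfM.
    have q_order := subp_order i ir.
    have q_zo : zero_or_order (fun x => (1 - p x r r)^-1) by right.
    (* The loop term vanishes when [r] is not in [Y r], so the exact order is drawn from the first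
       two terms. *)
    apply: zero_or_orderDl; last first.
      by do 3?apply: zero_or_orderM => //; exact: zero_or_orderM.
    case/orP: jY => [ji|/andP[ri jY]].
      apply: zero_or_orderDl; first exact: e_order.
      by apply: zero_or_orderM => //; apply: zero_or_orderD; exact: zero_or_orderM.
    apply: zero_or_orderDr => //; apply: has_orderM => //.
    (* The product [er x i r * p x r j] has an exact order, since [r] lies in [Y i] and [j] in
       [Y r]. *)
    apply: zero_or_orderDl; last exact: zero_or_orderM.
    by apply: has_orderM; [exact: e_order|exact: p_order].
  by move=> [h [c [c0 lim]]]; exists h, h, (fun=> c); exact: cvg_pivotal.
Qed.
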